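(* There exists a universal constant $c > 0$ (independent of $t$ and $f$) such that for every $t \in (0,1)$ and every $f$ in the Sobolev space $W^{1,1}(\mathbb{T})$ with $\int_{\mathbb{T}} f = 0$ we have $$\int_{\mathbb{T}} \left| f'(x) - \frac{f(x \oplus t) - f(x \oplus -t)}{2t} \right| dx \geq c t^2 \int_{\mathbb{T}} |f(x)| \, dx .$$
   Context: $\mathbb{T} = \mathbb{R}/\mathbb{Z}$ is the one-dimensional torus, a compact group with addition modulo 1, $x \oplus y = (x+y) \bmod 1$ for $x, y \in \mathbb{R}$, equipped with its Haar probability measure (Lebesgue measure on $[0,1)$). $W^{1,1}(\mathbb{T})$ is the space of functions in $L_1(\mathbb{T})$ whose weak derivative $f'$ on $\mathbb{T}$ is in $L_1(\mathbb{T})$. *)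

(* Defs.v *)
(* A function on the torus R/Z is a function R -> R of which only the values
   on the fundamental domain [0, 1[ matter; the Haar probability measure is
   the Lebesgue measure on that domain. *)
From HB Require Import structures.
From mathcomp Require Import all_boot all_order all_algebra.
From mathcomp Require Import all_classical all_reals all_analysis.

Set Implicit Arguments.
Unset Strict Implicit.
Unset Printing Implicit Defensive.

Import Order.TTheory GRing.Theory Num.Theory.
Import numFieldNormedType.Exports.

Local Open Scope ring_scope.
Local Open Scope classical_set_scope.

Definition torus {R : realType} : set R := `[0, 1[.

Definition tadd {R : realType} (x y : R) : R :=
  x + y - (Num.floor (x + y))%:~R.

Notation "x ⊕ y" := (tadd x y) (at level 50, left associativity) : ring_scope.

Definition torus_L1 {R : realType} (f : R -> R) : Prop :=
  lebesgue_measure.-integrable torus (EFin \o f).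

(* C^oo functions on the torus are the 1-periodic functions on the line that
   have derivatives of all orders (hence continuous ones). *)
Definition torus_smooth {R : realType} (phi : R -> R) : Prop :=
  periodic phi 1 /\ forall (n : nat) (x : R), derivable (phi^`(n)) x 1.

(* The torus is compact, so its locally integrable functions, among which weak
   derivatives are sought, are the integrable ones. *)
Definition is_weak_derivative {R : realType} (f g : R -> R) : Prop :=
  torus_L1 g /\
  forall phi : R -> R, torus_smooth phi ->
    (\int[lebesgue_measure]_(x in torus) (f x * derive1 phi x)%:E =
     - \int[lebesgue_measure]_(x in torus) (g x * phi x)%:E)%E.

Definition torus_W11 {R : realType} (f : R -> R) : Prop :=
  torus_L1 f /\ exists g : R -> R, is_weak_derivative f g.

(* Main.v *)
Require Import Defs.
From HB Require Import structures.
From mathcomp Require Import all_boot all_order all_algebra.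
From mathcomp Require Import all_classical all_reals all_analysis.
From mathcomp Require Import measurable_realfun ring lra.
Import Order.TTheory GRing.Theory Num.Theory.
Import numFieldNormedType.Exports.
Local Open Scope classical_set_scope.
Local Open Scope ring_scope.

(** The theorem is a spectral gap in disguise. Let A be the average over
    [-t, t], A f (x) = (2 t)^-1 * (the integral of f over [x - t, x + t]). As
    (A f)' (x) = (f (x + t) - f (x - t)) / (2 t), the theorem bounds the L1 norm
    of the derivative of G = f - A f from below.

    On the one hand f has mean zero, so that pairing f with G or with G - G 0
    gives the same number, and it is at most |f|_1 |G'|_1 because G' controls
    the oscillation of G. On the other hand the pairing is an average of
    quadratic variations of f,
      <f, G> = (4 t)^-1 * (the integral over s in [-t, t] of N (s)),
    where N (s) is the square of the L2 norm of f (. + s) - f. For f of mean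
    zero the integral of N over a whole period is 2 |f|_2^2, and the triangle
    inequality N (k s) <= k^2 N (s) allows one to rescale the period into
    [-t, t], with an integer k of order 1/t (lemma spectral_gap). Thus
      t^2 |f|_1^2 <= t^2 |f|_2^2 <= 16 <f, G> <= 16 |f|_1 |G'|_1,
    and c = 1/16 (lemma L1_difference_estimate).

    This argument is for a function F that is an integral of its derivative
    g = f'. A function f with weak derivative g agrees almost everywhere with
    such an F (lemma weak_derivative_primitive): testing the definition of weak
    derivative with primitives of smooth approximations of indicators
    determines the integrals of f over all intervals [0, a[, and they are those
    of the primitive of g. Since F has to be integrated over translated and
    rescaled intervals, it is extended to the line by periodicity, and only
    used as a bounded measurable function. *)

(** * Real-valued integrals over half-open intervals *)

Section interval_integrals.
Set Implicit Arguments.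
Unset Strict Implicit.
Context {R : realType}.
Notation mu := (@lebesgue_measure R).
Implicit Types (a b c k s M : R) (h u v : R -> R).

(** Intervals closed on the left and open on the right make integrals additive
    without boundary terms, and [0, 1[ is the fundamental domain itself. *)
Definition itvint a b h : R := \int[mu]_(x in `[a, b[) h x.

Definition itvintegrable a b h := mu.-integrable `[a, b[ (EFin \o h).

(** A class of integrands that are integrable on every interval. Unlike
    continuity, membership survives composition with the reduction modulo 1. *)
Definition bounded_measurable h :=
  measurable_fun setT h /\ exists M, forall x, `|h x| <= M.

Lemma bounded_measurable_integrable a b h :
  bounded_measurable h -> itvintegrable a b h.
Proof.
move=> [mh [M hM]]; apply: measurable_bounded_integrable => //.
- rewrite (_ : _ `[a, b[%classic = mu `[a, b[%classic)// lebesgue_measure_itv/=.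
  by case: ifP => _; rewrite ?ltry// -EFinB ltry.
- exact: measurable_funS mh.
- exists M; split; first exact: num_real.
  by move=> x Mx y _; apply: le_trans (ltW Mx); exact: hM.
Qed.

Lemma bounded_measurable_cst c : bounded_measurable (fun=> c).
Proof. by split; [exact: measurable_cst|exists `|c|]. Qed.

Lemma bounded_measurableM u v : bounded_measurable u -> bounded_measurable v ->
  bounded_measurable (fun x => u x * v x).
Proof.
move=> [mu_ [M uM]] [mv [N vN]]; split; first exact: measurable_funM.
by exists (M * N) => x; rewrite normrM ler_pM.
Qed.

Lemma bounded_measurableB u v : bounded_measurable u -> bounded_measurable v ->
  bounded_measurable (fun x => u x - v x).
Proof.
move=> [mu_ [M uM]] [mv [N vN]]; split; first exact: measurable_funB.
by exists (M + N) => x; rewrite (le_trans (ler_normB _ _))// lerD.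
Qed.

Lemma bounded_measurable_norm u : bounded_measurable u ->
  bounded_measurable (fun x => `|u x|).
Proof.
move=> [mu_ [M uM]]; split; first exact: measurableT_comp.
by exists M => x; rewrite normr_id.
Qed.

Lemma bounded_measurable_affine k s u : bounded_measurable u ->
  bounded_measurable (fun x => u (k * x + s)).
Proof.
move=> [mu_ [M uM]]; split; last by exists M.
by apply: (measurableT_comp mu_); apply: measurable_funD.
Qed.

Lemma itvint_eq a b u v : (forall x, a <= x < b -> u x = v x) ->
  itvint a b u = itvint a b v.
Proof.
by move=> uv; apply: eq_Rintegral => x; rewrite inE/= in_itv/=; exact: uv.
Qed.

Lemma itvint_cst a b c : a <= b -> itvint a b (fun=> c) = c * (b - a).
Proof.
move=> ab; rewrite /itvint Rintegral_cst//; congr (_ * _).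
rewrite (_ : _ `[a, b[%classic = mu `[a, b[%classic)// lebesgue_measure_itv/=.
rewrite lte_fin; case: ltgtP ab => // -> _.
by rewrite subrr.
Qed.

Lemma itvintegrableZ a b c u : itvintegrable a b u ->
  itvintegrable a b (fun x => c * u x).
Proof.
by move=> iu; apply: eq_integrable (integrableZl _ c iu) => // x _.
Qed.

Lemma itvintegrableD a b u v : itvintegrable a b u -> itvintegrable a b v ->
  itvintegrable a b (fun x => u x + v x).
Proof.
by move=> iu iv; apply: eq_integrable (integrableD _ iu iv) => // x _.
Qed.

Lemma itvintegrableB a b u v : itvintegrable a b u -> itvintegrable a b v ->
  itvintegrable a b (fun x => u x - v x).
Proof.
by move=> iu iv; apply: eq_integrable (integrableB _ iu iv) => // x _.
Qed.

Lemma itvintegrable_norm a b u : itvintegrable a b u ->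
  itvintegrable a b (fun x => `|u x|).
Proof. by move=> iu; exact: integrable_norm iu. Qed.

Lemma itvintD a b u v : itvintegrable a b u -> itvintegrable a b v ->
  itvint a b (fun x => u x + v x) = itvint a b u + itvint a b v.
Proof. by move=> iu iv; exact: RintegralD. Qed.

Lemma itvintB a b u v : itvintegrable a b u -> itvintegrable a b v ->
  itvint a b (fun x => u x - v x) = itvint a b u - itvint a b v.
Proof. by move=> iu iv; exact: RintegralB. Qed.

Lemma itvintZ a b c u : itvintegrable a b u ->
  itvint a b (fun x => c * u x) = c * itvint a b u.
Proof. by move=> iu; exact: RintegralZl. Qed.

Lemma itvint_ge0 a b u : (forall x, 0 <= u x) -> 0 <= itvint a b u.
Proof. by move=> u0; exact: Rintegral_ge0. Qed.

Lemma le_itvint a b u v : itvintegrable a b u -> itvintegrable a b v ->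
  (forall x, a <= x < b -> u x <= v x) -> itvint a b u <= itvint a b v.
Proof.
by move=> iu iv uv; apply: le_Rintegral => // x; rewrite /= in_itv/=; exact: uv.
Qed.

Lemma ler_norm_itvint a b u : itvintegrable a b u ->
  `|itvint a b u| <= itvint a b (fun x => `|u x|).
Proof. by move=> iu; exact: le_normr_Rintegral. Qed.

Lemma itvintegrable_sub a b c d u : a <= c -> d <= b ->
  itvintegrable a b u -> itvintegrable c d u.
Proof.
move=> ac db; apply: integrableS => //.
by apply: subset_itv; rewrite bnd_simp.
Qed.

Lemma itvint_split a b c u : a <= b -> b <= c -> itvintegrable a c u ->
  itvint a c u = itvint a b u + itvint b c u.
Proof.
move=> ab bc iu; rewrite /itvint -Rintegral_setU//.
- by rewrite -itv_bndbnd_setU// bnd_simp.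
- by rewrite -itv_bndbnd_setU// bnd_simp.
- apply/disj_setPS => y [/=]; rewrite 2!in_itv/= => /andP[_ yb] /andP[].
  by rewrite leNgt yb.
Qed.

Lemma le_itvint_subset a b c d u : a <= c -> c <= d -> d <= b ->
  itvintegrable a b u -> (forall x, 0 <= u x) -> itvint c d u <= itvint a b u.
Proof.
move=> ac cd db iu u0; have cb := le_trans cd db.
rewrite (itvint_split ac cb)// (itvint_split cd db).
  by rewrite addrCA lerDl addr_ge0// itvint_ge0.
exact: itvintegrable_sub iu.
Qed.

Lemma integral_mscale (k : {nonneg R}) (D : set R) (f : R -> \bar R) :
  measurable D -> mu.-integrable D f ->
  (\int[mscale k mu]_(x in D) f x = k%:num%:E * \int[mu]_(x in D) f x)%E.
Proof.
move=> mD fi; have mf := measurable_int _ fi.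
rewrite integralE [in RHS]integralE muleBr//; last exact: integrable_add_def.
congr (_ - _)%E; rewrite ge0_integral_mscale//.
- exact: measurable_funepos.
- exact: measurable_funeneg.
Qed.

(** Both sides are measures in A, so comparing them on intervals is enough. *)
Lemma lebesgue_measure_affine k s (A : set R) : 0 < k -> measurable A ->
  (k%:E * mu ((fun x => (k * x + s)%R) @^-1` A) = mu A)%E.
Proof.
move=> k0 mA; pose phi : measurableTypeR R -> measurableTypeR R :=
  fun x => (k * x + s)%R.
have mphi : measurable_fun setT phi.
  by apply: measurable_funD => //; exact: measurable_funM.
pose nu : {measure set (measurableTypeR R) -> \bar R} :=
  mscale (NngNum (ltW k0)) (pushforward mu phi).
rewrite [RHS](@lebesgue_measure_unique _ (nu mphi))// => _ [[a b]] _ <-.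
rewrite /nu/= /mscale/= /pushforward.
rewrite (_ : phi @^-1` _ = `](a - s) / k, (b - s) / k]%classic); last first.
  apply/seteqP; split => x;
    rewrite /= !in_itv/= /phi ltr_pdivrMr// ler_pdivlMr//;
    by rewrite ltrBlDr lerBrDr (mulrC x).
rewrite !lebesgue_measure_itv/= !lte_fin ltr_pM2r ?invr_gt0// ltrD2r.
case: ifP => _; last by rewrite mule0.
by rewrite -!EFinB -EFinM; congr EFin; field; rewrite gt_eqF.
Qed.

Lemma itvint_affine a b k s h : 0 < k -> bounded_measurable h ->
  itvint (k * a + s) (k * b + s) h = k * itvint a b (fun x => h (k * x + s)).
Proof.
move=> k0 bh; pose phi : measurableTypeR R -> measurableTypeR R :=
  fun x => (k * x + s)%R.
have mphi : measurable_fun setT phi.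
  by apply: measurable_funD => //; exact: measurable_funM.
have phiab : phi @^-1` `[k * a + s, k * b + s[ = `[a, b[%classic.
  by apply/seteqP; split => x;
    rewrite /= !in_itv/= /phi lerD2r ltrD2r !ler_pM2l// !ltr_pM2l.
pose nu : {measure set (measurableTypeR R) -> \bar R} :=
  mscale (NngNum (ltW k0)) mu.
have munu (A : set R) : measurable A -> mu A = pushforward nu phi A.
  by move=> mA; rewrite /pushforward/= /mscale/= -(@lebesgue_measure_affine k s _ k0 mA).
have ih := bounded_measurable_integrable a b (bounded_measurable_affine k s bh).
rewrite /itvint/= /Rintegral.
rewrite (eq_measure_integral (pushforward nu phi)); last first.
  by move=> A mA _; exact: munu.
have inu : nu.-integrable `[a, b[ (EFin \o h \o phi).
  apply/integrableP; split; first exact: measurable_int ih.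
  rewrite ge0_integral_mscale//; last first.
    by apply: measurableT_comp => //; exact: measurable_int ih.
  by rewrite lte_mul_pinfty// ?lee_fin ?ltW//; case/integrableP : ih.
rewrite (@integral_pushforward _ _ _ _ _ phi mphi nu _ (EFin \o h))//.
- rewrite phiab integral_mscale//= fineM//.
  exact: integrable_fin_num.
- by apply/measurable_EFinP; exact: bh.1.
- by rewrite phiab.
Qed.
End interval_integrals.

(** * Integrals depending on a parameter *)

Section parameter_integrals.
Set Implicit Arguments.
Unset Strict Implicit.
Context {R : realType}.
Notation mu := (@lebesgue_measure R).
Implicit Types (a b c d x y : R) (g h : R -> R) (K : R * R -> R).

Lemma measurable_pairl K x : measurable_fun setT K ->
  measurable_fun setT (fun y => K (x, y)).
Proof. by move=> mK; apply: (measurableT_comp mK); exact: measurable_pair1. Qed.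

Lemma measurable_pairr K y : measurable_fun setT K ->
  measurable_fun setT (fun x => K (x, y)).
Proof. by move=> mK; apply: (measurableT_comp mK); exact: measurable_pair2. Qed.

Lemma dominated_itvintegrable a b g h : measurable_fun setT h ->
  itvintegrable a b g -> (forall y, a <= y < b -> `|h y| <= g y) ->
  itvintegrable a b h.
Proof.
move=> mh ig hg; apply: (le_integrable _ _ _ ig) => //.
- by apply/measurable_EFinP; exact: measurable_funS mh.
- by move=> y /=; rewrite in_itv/= lee_fin => /hg/le_trans; apply; exact: ler_norm.
Qed.

Lemma itvintE a b h : itvintegrable a b h ->
  ((itvint a b h)%:E = \int[mu]_(y in `[a, b[) (h y)%:E)%E.
Proof. by move=> ih; rewrite /itvint/Rintegral fineK//; exact: integrable_fin_num. Qed.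

(** Tonelli's theorem gives measurability for nonnegative integrands; adding the
    dominating function g reduces the signed case to that one. *)
Lemma measurable_itvint c d K g : measurable_fun setT K ->
  itvintegrable c d g -> measurable_fun setT g ->
  (forall x y, `|K (x, y)| <= g y) ->
  measurable_fun setT (fun x => itvint c d (fun y => K (x, y))).
Proof.
move=> mK ig mg Kg.
have iK x := dominated_itvintegrable (measurable_pairl x mK) ig (fun y _ => Kg x y).
rewrite (_ : (fun x => _) = fun x =>
    itvint c d (fun y => K (x, y) + g y) - itvint c d g); last first.
  by apply/funext => x; rewrite itvintD// addrK.
apply: measurable_funB => //.
pose L (z : R * R) := (((fun y => K (z.1, y) + g y) \_ `[c, d[) z.2)%:E.
have L0 z : (0 <= L z)%E.
  rewrite lee_fin /L patchE; case: ifP => // _.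
  by have := Kg z.1 z.2; rewrite ler_norml => /andP[]; lra.
have mL : measurable_fun setT L.
  apply/measurable_EFinP.
  rewrite (_ : (fun z => _) = (fun z => (K z + g z.2) * \1_`[c, d[ z.2)).
    apply: measurable_funM.
      by apply: measurable_funD => //; exact: measurableT_comp.
    by apply: measurableT_comp => //; exact: measurable_indic.
  apply/funext => -[x y]; rewrite patchE indicE /=.
  by case: ifP; rewrite ?mulr1 ?mulr0.
have := @measurable_fun_fubini_tonelli_F _ _ _ _ R mu L mL L0.
move=> /(measurableT_comp (@fine_measurable R setT measurableT)).
apply: eq_measurable_fun => x _ /=.
rewrite /itvint /Rintegral /fubini_F [in RHS]integral_mkcond /=; congr fine.
by apply: eq_integral => y _; rewrite /L /= restrict_EFin.
Qed.

Lemma bounded_measurable_itvint c d K M : measurable_fun setT K ->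
  (forall z, `|K z| <= M) ->
  bounded_measurable (fun x => itvint c d (fun y => K (x, y))).
Proof.
move=> mK KM.
have iM : itvintegrable c d (fun=> M).
  exact/bounded_measurable_integrable/bounded_measurable_cst.
have iK x : itvintegrable c d (fun y => K (x, y)).
  by apply: dominated_itvintegrable iM _ => //; exact: measurable_pairl.
split; first exact: (measurable_itvint (g := fun=> M)).
exists (itvint c d (fun=> M)) => x.
rewrite (le_trans (ler_norm_itvint (iK x)))// le_itvint//.
exact: itvintegrable_norm.
Qed.

Lemma integral_itv_indic a b h :
  (\int[mu]_(x in `[a, b[) (h x)%:E = \int[mu]_x (h x * \1_`[a, b[ x)%:E)%E.
Proof.
rewrite integral_mkcond; apply: eq_integral => x _; rewrite patchE indicE.
by case: ifP => _; rewrite ?mulr1 ?mulr0.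
Qed.

(** The dominating function may depend on y alone because the interval of
    integration in x is bounded. *)
Lemma fubini_itvint a b c d K g : measurable_fun setT K ->
  itvintegrable c d g -> measurable_fun setT g ->
  (forall x y, `|K (x, y)| <= g y) ->
  itvint a b (fun x => itvint c d (fun y => K (x, y))) =
  itvint c d (fun y => itvint a b (fun x => K (x, y))).
Proof.
move=> mK ig mg Kg.
have iK x : itvintegrable c d (fun y => K (x, y)) :=
  dominated_itvintegrable (measurable_pairl x mK) ig (fun y _ => Kg x y).
have iK' y : itvintegrable a b (fun x => K (x, y)).
  apply: bounded_measurable_integrable; split; first exact: measurable_pairr.
  by exists (g y) => x.
pose L (z : R * R) := K z * (\1_`[a, b[ z.1 * \1_`[c, d[ z.2).
have mL : measurable_fun setT L.
  apply: measurable_funM => //; apply: measurable_funM => //.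
    by apply: measurableT_comp => //; exact: measurable_indic.
  by apply: measurableT_comp => //; exact: measurable_indic.
have iL : (mu \x mu)%E.-integrable setT (EFin \o L).
  apply/integrable12ltyP; first exact/measurable_EFinP.
  have itv1 : itvintegrable a b (fun=> itvint c d g).
    exact/bounded_measurable_integrable/bounded_measurable_cst.
  apply: (@le_lt_trans _ _ (\int[mu]_(y in `[a, b[) (itvint c d g)%:E)%E); last first.
    by rewrite -itvintE// ltry.
  rewrite integral_itv_indic; apply: ge0_le_integral => //.
  - by move=> y _; exact: integral_ge0.
  - apply: (@measurable_fun_fubini_tonelli_F _ _ _ _ R mu (abse \o (EFin \o L))) => //.
    + by apply: measurableT_comp => //; exact/measurable_EFinP.
    + by move=> z; exact: abse_ge0.
  - by apply/measurable_EFinP; apply: measurable_funM => //; exact: measurable_indic.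
  - move=> x _; rewrite mulrC -itvintZ// itvintE; last exact: itvintegrableZ.
    rewrite integral_itv_indic; apply: ge0_le_integral => //.
    + apply: measurableT_comp => //; apply/measurable_EFinP.
      exact: measurable_pairl.
    + apply/measurable_EFinP; apply: measurable_funM; last exact: measurable_indic.
      exact: measurable_funM.
    + move=> y _ /=; rewrite lee_fin /L normrM (@ger0_norm _ (_ * _)) ?mulr_ge0//=.
      by rewrite mulrCA mulrA ler_wpM2r// ler_wpM2l.
rewrite /itvint /Rintegral; congr fine.
transitivity (\int[mu]_x \int[mu]_y (EFin \o L) (x, y))%E.
  rewrite integral_itv_indic; apply: eq_integral => x _.
  rewrite mulrC -[fine _]/(itvint _ _ _) -itvintZ// itvintE; last exact: itvintegrableZ.
  rewrite integral_itv_indic; apply: eq_integral => y _.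
  by rewrite /= /L mulrCA mulrA.
rewrite Fubini// [RHS]integral_itv_indic; apply: eq_integral => y _.
rewrite mulrC -[fine _]/(itvint _ _ _) -itvintZ// itvintE; last exact: itvintegrableZ.
rewrite integral_itv_indic; apply: eq_integral => x _.
by rewrite /= /L; congr EFin; ring.
Qed.
End parameter_integrals.

(** * Periodic functions and the spectral gap *)

Section periodic_functions.
Set Implicit Arguments.
Unset Strict Implicit.
Context {R : realType}.
Implicit Types (a b s x y : R) (h F : R -> R).

Lemma bounded_measurable_shift s h : bounded_measurable h ->
  bounded_measurable (fun x => h (x + s)).
Proof.
move=> /(bounded_measurable_affine 1 s); congr bounded_measurable.
by apply/funext => x; rewrite mul1r.
Qed.

Lemma itvint_shift a b s h : bounded_measurable h ->
  itvint a b (fun x => h (x + s)) = itvint (a + s) (b + s) h.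
Proof.
move=> bh; have := itvint_affine a b s ltr01 bh.
by rewrite !mul1r => ->; apply: itvint_eq => x _; rewrite mul1r.
Qed.

Lemma periodic_int h (n : int) x : periodic h 1 -> h (x + n%:~R) = h x.
Proof.
move=> ph; have pn (m : nat) y : h (y + m%:R) = h y by rewrite periodicn.
case: (intP n) => [|m|m]; first by rewrite addr0.
  by rewrite -pmulrn pn.
by rewrite -[in RHS](subrK m.+1%:R x) pn -nmulrn.
Qed.

Lemma itvint_periodic h s : bounded_measurable h -> periodic h 1 ->
  itvint 0 1 (fun x => h (x + s)) = itvint 0 1 h.
Proof.
move=> bh ph; pose r := s - (Num.floor s)%:~R.
have r0 : 0 <= r by rewrite subr_ge0 floor_le.
have r1 : r <= 1 by rewrite lerBlDl -intrD1 ltW// floorD1_gt.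
have -> : (fun x => h (x + s)) = fun x => h (x + r).
  by apply/funext => x; rewrite -[RHS](periodic_int (Num.floor s))// /r -addrA subrK.
have ih u v := bounded_measurable_integrable u v bh.
rewrite itvint_shift// add0r (itvint_split r1)//; last by rewrite lerDl.
rewrite [RHS](itvint_split r0 r1)// [LHS]addrC; congr (_ + _).
have -> : itvint 1 (1 + r) h = itvint (0 + 1) (r + 1) h by rewrite add0r addrC.
by rewrite -itvint_shift//; apply: itvint_eq => x _; exact: ph.
Qed.

End periodic_functions.

Section autocorrelation.
Set Implicit Arguments.
Unset Strict Implicit.
Context {R : realType}.
Implicit Types (a b s x y t : R).
Variable F : R -> R.
Hypotheses (bF : bounded_measurable F) (pF : periodic F 1).

Let autocor s := itvint 0 1 (fun x => F x * F (x + s)).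
Let variation s := itvint 0 1 (fun x => (F (x + s) - F x) ^+ 2).

Let bFs s : bounded_measurable (fun x => F (x + s)).
Proof. exact: bounded_measurable_shift. Qed.

Let bcor s : bounded_measurable (fun x => F x * F (x + s)).
Proof. exact: bounded_measurableM. Qed.

Let bvar s : bounded_measurable (fun x => (F (x + s) - F x) ^+ 2).
Proof. by apply: bounded_measurableM; exact: bounded_measurableB. Qed.

Let iB a b h : bounded_measurable h -> itvintegrable a b h.
Proof. exact: bounded_measurable_integrable. Qed.

Let autocor0 : autocor 0 = itvint 0 1 (fun x => F x ^+ 2).
Proof. by apply: itvint_eq => x _; rewrite addr0. Qed.

(** Expand the square: both squares integrate to autocor 0 by periodicity. *)
Let variationE s : variation s = 2 * autocor 0 - 2 * autocor s.
Proof.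
have bF2 : bounded_measurable (fun x => F x ^+ 2) by exact: bounded_measurableM.
have shift2 : itvint 0 1 (fun x => F (x + s) ^+ 2) = autocor 0.
  rewrite autocor0 (@itvint_periodic _ (fun x => F x ^+ 2))// => x.
  by rewrite pF.
have bFs2 : bounded_measurable (fun x => F (x + s) ^+ 2).
  exact: (bounded_measurable_shift _ bF2).
have icor : itvintegrable 0 1 (fun x => 2 * (F x * F (x + s))).
  by apply: itvintegrableZ; exact: iB.
have : variation s + 2 * autocor s = autocor 0 + autocor 0.
  have -> : 2 * autocor s = itvint 0 1 (fun x => 2 * (F x * F (x + s))).
    by rewrite itvintZ//; exact: iB.
  rewrite -{1}shift2 autocor0 /variation -itvintD; [|exact: iB|exact: icor].
  rewrite -itvintD; [|exact: iB|exact: iB].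
  by apply: itvint_eq => x _; ring.
by move=> H; rewrite mulr_natl mulr2n -H addrK.
Qed.

(** The square root of the variation is the L2 distance of F to its translate
    by s, hence subadditive in s. The induction uses the weighted inequality
    n (p + q)^2 <= (n + 1) p^2 + n (n + 1) q^2 in place of square roots. *)
Let variation_mulrn s n : variation (s *+ n) <= n%:R ^+ 2 * variation s.
Proof.
elim: n => [|n IH].
  by rewrite mulr0n expr0n mul0r variationE subrr.
have [->|n0] := eqVneq n 0%N; first by rewrite mulr1n expr1n mul1r.
have {}n0 : 0 < n%:R :> R by rewrite ltr0n lt0n.
rewrite -(ler_pM2l n0).
have shiftn : itvint 0 1 (fun x => (F (x + s + s *+ n) - F (x + s)) ^+ 2) =
    variation (s *+ n).
  rewrite (@itvint_periodic _ (fun x => (F (x + s *+ n) - F x) ^+ 2))//.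
  by move=> x; rewrite pF addrAC pF.
have bshift : bounded_measurable (fun x => (F (x + s + s *+ n) - F (x + s)) ^+ 2).
  exact: (bounded_measurable_shift _ (bvar (s *+ n))).
apply: (@le_trans _ _ ((n%:R + 1) * variation (s *+ n) +
    n%:R * (n%:R + 1) * variation s)); last first.
  have : (n%:R + 1) * variation (s *+ n) <=
      (n%:R + 1) * (n%:R ^+ 2 * variation s).
    by rewrite ler_wpM2l// addr_ge0// ltW.
  have -> : n.+1%:R = n%:R + 1 :> R by rewrite -natr1.
  nra.
rewrite -shiftn -!itvintZ; [|exact: iB ..].
rewrite -itvintD; [|by apply: itvintegrableZ; exact: iB ..].
apply: le_itvint => [||x _].
- by apply: itvintegrableZ; exact: iB.
- by apply: itvintegrableD; apply: itvintegrableZ; exact: iB.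
have -> : x + s *+ n.+1 = x + s + s *+ n by rewrite mulrS addrA.
set A := F (_ + s *+ n); set B := F (x + s); set C := F x.
have := sqr_ge0 (A - B - n%:R * (B - C)); nra.
Qed.

Let autocor_integral a b :
  itvint a b autocor = itvint 0 1 (fun x => F x * itvint a b (fun s => F (x + s))).
Proof.
have [mF [M FM]] := bF.
pose K (z : R * R) := F z.2 * F (z.2 + z.1).
have mK : measurable_fun setT K.
  apply: measurable_funM; first exact: measurableT_comp.
  by apply: measurableT_comp => //; exact: measurable_funD.
have ig : itvintegrable 0 1 (fun=> M * M) by exact/iB/bounded_measurable_cst.
have KM s x : `|K (s, x)| <= M * M by rewrite normrM ler_pM.
rewrite [LHS](@fubini_itvint R a b 0 1 K (fun=> M * M))//.
apply: itvint_eq => x _; rewrite /K/= itvintZ//; apply: iB.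
have := bFs x; congr bounded_measurable.
by apply/funext => s; rewrite addrC.
Qed.

Let bautocor : bounded_measurable autocor.
Proof.
have [mF [M FM]] := bF.
pose K (z : R * R) := F z.2 * F (z.2 + z.1).
have mK : measurable_fun setT K.
  apply: measurable_funM; first exact: measurableT_comp.
  by apply: measurableT_comp => //; exact: measurable_funD.
by apply: (@bounded_measurable_itvint _ _ _ K (M * M)) => // z; rewrite normrM ler_pM.
Qed.

Let bvariation : bounded_measurable variation.
Proof.
rewrite (_ : variation = fun s => 2 * autocor 0 - 2 * autocor s).
  apply: bounded_measurableB; first exact: bounded_measurable_cst.
  by apply: bounded_measurableM => //; exact: bounded_measurable_cst.
by apply/funext => s; rewrite variationE.
Qed.

Let itvint_variation a b : a <= b -> itvint a b variation =
  2 * (b - a) * autocor 0 - 2 * itvint a b autocor.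
Proof.
move=> ab; rewrite -itvintZ; last exact: iB.
have -> : 2 * (b - a) * autocor 0 = itvint a b (fun=> 2 * autocor 0).
  by rewrite itvint_cst// mulrAC.
rewrite -itvintB; last 2 first.
- exact/iB/bounded_measurable_cst.
- by apply: itvintegrableZ; exact: iB.
by apply: itvint_eq => s _; rewrite variationE.
Qed.

Hypothesis F0 : itvint 0 1 F = 0.

(** The integral of F over a full period vanishes, so the average of the
    autocorrelation over all translations is zero. *)
Let itvint_variation01 : itvint 0 1 variation = 2 * autocor 0.
Proof.
rewrite itvint_variation// autocor_integral.
rewrite (_ : itvint 0 1 _ = 0) ?mulr0 ?subr0 ?mulr1//.
transitivity (itvint 0 1 (fun=> 0) : R); last by rewrite itvint_cst// mul0r.
apply: itvint_eq => x _.
rewrite (_ : itvint _ _ _ = 0) ?mulr0//.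
transitivity (itvint 0 1 (fun s => F (s + x))); last by rewrite itvint_periodic.
by apply: itvint_eq => s _; rewrite addrC.
Qed.

(** Substitute s = k x and apply variation_mulrn: small translations control
    all of them. *)
Let itvint_variation_rescale k : (0 < k)%N ->
  itvint 0 1 variation <= k%:R ^+ 3 * itvint 0 (k%:R^-1) variation.
Proof.
move=> k0; have k0' : 0 < k%:R :> R by rewrite ltr0n.
have -> : itvint 0 1 variation =
    k%:R * itvint 0 (k%:R^-1) (fun x => variation (k%:R * x + 0)).
  rewrite -itvint_affine// mulr0 !addr0 divff//.
  by rewrite pnatr_eq0 -lt0n.
rewrite exprS -mulrA ler_wpM2l//.
rewrite -itvintZ; last exact: iB.
apply: le_itvint.
- by apply: iB; exact: bounded_measurable_affine.
- by apply: itvintegrableZ; exact: iB.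
- by move=> x _; rewrite addr0 mulr_natl variation_mulrn.
Qed.

(** Averaging over the translations by s in [-t, t[ is an operator A on L2, and
    this is a lower bound of order t^2 for the spectrum of 1 - A on functions of
    mean zero. The pairing of F with (1 - A) F is the average over [-t, t[ of
    half the variation of F, whose average over a whole period is the squared
    norm of F. The first is related to the second by rescaling with an integer
    k such that 1/k <= t, which costs a factor k^3. *)
Lemma spectral_gap t : 0 < t < 1 ->
  t ^+ 2 * itvint 0 1 (fun x => F x ^+ 2) <=
  16 * itvint 0 1 (fun x =>
    F x * (F x - itvint (- t) t (fun s => F (x + s)) / (2 * t))).
Proof.
move=> /andP[t0 t1].
(* 1/k <= t makes the rescaled interval fit into [-t, t[; k <= 2/t bounds the
   loss, and gives the constant 16 = 2 * 2^3 *)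
pose k := (Num.trunc t^-1).+1.
have k0 : 0 < k%:R :> R by rewrite ltr0n.
have ti1 : 1 < t^-1 by rewrite invf_gt1.
have tk : t^-1 < k%:R by rewrite /k truncnS_gt.
have kt : k%:R <= 2 / t.
  have : (Num.trunc t^-1)%:R <= t^-1 by rewrite truncn_le invr_ge0 ltW.
  by rewrite /k -natr1; lra.
have ikt : k%:R^-1 <= t by rewrite -[t]invrK lef_pV2// ?posrE ?invr_gt0// ltW.
set E := itvint 0 1 (fun x => F x * _).
have EE : 2 * t * E = 2 * t * autocor 0 - itvint (- t) t autocor.
  have bW : bounded_measurable (fun x => itvint (- t) t (fun s => F (x + s))).
    have [mF [M FM]] := bF.
    apply: (@bounded_measurable_itvint _ _ _ (fun z => F (z.1 + z.2)) M) => //.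
    by apply: measurableT_comp => //; exact: measurable_funD.
  have bF2 : bounded_measurable (fun x => F x ^+ 2) by exact: bounded_measurableM.
  have bFW := bounded_measurableM bF bW.
  have bG : bounded_measurable
      (fun x => F x - itvint (- t) t (fun s => F (x + s)) / (2 * t)).
    apply: bounded_measurableB => //; apply: bounded_measurableM => //.
    exact: bounded_measurable_cst.
  have bE := bounded_measurableM bF bG.
  rewrite autocor_integral autocor0.
  rewrite -itvintZ; last exact: iB.
  rewrite -itvintZ; last exact: iB.
  rewrite -itvintB; [|by apply: itvintegrableZ; exact: iB|exact: iB].
  by apply: itvint_eq => x _; field; rewrite gt_eqF.
have tNt : - t <= t by lra.
have varE : itvint (- t) t variation = 4 * (t * E).
  by rewrite itvint_variation//; lra.
have E0 : 0 <= E.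
  have : 0 <= itvint (- t) t variation.
    by apply: itvint_ge0 => s; apply: itvint_ge0 => x; exact: sqr_ge0.
  by rewrite varE !pmulr_rge0.
have : 2 * autocor 0 <= k%:R ^+ 3 * (4 * (t * E)).
  rewrite -itvint_variation01 (le_trans (itvint_variation_rescale (k := k) _))//.
  rewrite ler_wpM2l ?exprn_ge0// -varE; apply: le_itvint_subset => //.
  - by rewrite oppr_le0 ltW.
  - exact: iB.
  - by move=> s; apply: itvint_ge0 => x; exact: sqr_ge0.
have tk2 : (t * k%:R) ^+ 3 <= 2 ^+ 3.
  have tk1 : t * k%:R <= 2 by rewrite mulrC -ler_pdivlMr.
  by rewrite lerXn2r ?nnegrE ?mulr_ge0// ltW.
rewrite -autocor0 => H.
have : t ^+ 2 * (2 * autocor 0) <= t ^+ 2 * (k%:R ^+ 3 * (4 * (t * E))).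
  by rewrite ler_wpM2l ?exprn_ge0// ltW.
have : (t * k%:R) ^+ 3 * E <= 2 ^+ 3 * E by rewrite ler_wpM2r.
have -> : t ^+ 2 * (k%:R ^+ 3 * (4 * (t * E))) = 4 * ((t * k%:R) ^+ 3 * E) by ring.
lra.
Qed.
End autocorrelation.

(** * The estimate for absolutely continuous functions *)

Section difference_estimate.
Set Implicit Arguments.
Unset Strict Implicit.
Context {R : realType}.
Implicit Types (a b s x y t : R).

(** The variance of the absolute value of F is nonnegative. *)
Lemma sqr_itvint01_le F : bounded_measurable F ->
  (itvint 0 1 (fun x => `|F x|)) ^+ 2 <= itvint 0 1 (fun x => F x ^+ 2) :> R.
Proof.
move=> bF; set m := itvint _ _ _.
have bN := bounded_measurable_norm bF.
have bF2 : bounded_measurable (fun x => F x ^+ 2) by exact: bounded_measurableM.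
have iB h : bounded_measurable h -> itvintegrable 0 1 h.
  exact: bounded_measurable_integrable.
have i2 : itvintegrable 0 1 (fun x => 2 * m * `|F x|) by exact/itvintegrableZ/iB.
have icst : itvintegrable 0 1 (fun=> m ^+ 2) by exact/iB/bounded_measurable_cst.
have : 0 <= itvint 0 1 (fun x => (`|F x| - m) ^+ 2).
  by apply: itvint_ge0 => x; exact: sqr_ge0.
have -> : itvint 0 1 (fun x => (`|F x| - m) ^+ 2) =
    itvint 0 1 (fun x => F x ^+ 2) - 2 * m * m + m ^+ 2.
  have -> : m ^+ 2 = itvint 0 1 (fun=> m ^+ 2) by rewrite itvint_cst// subr0 mulr1.
  rewrite -{2}/m -{1}itvintZ; last exact: iB.
  rewrite -itvintB; [|exact: iB|exact: i2].
  rewrite -itvintD; [|by apply: itvintegrableB => //; exact: iB|exact: icst].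
  by apply: itvint_eq => x _; rewrite -(real_normK (num_real (F x))); ring.
lra.
Qed.

(** Let G = F - A F, with A F x the average of F over [x - t, x + t[. The
    integrand on the right is the absolute value of the derivative of G, so its
    integral bounds the oscillation of G. As F has mean zero, pairing F with G
    is the same as pairing it with G - G 0, which gives
    <F, G> <= |F|_1 * |G'|_1. The spectral gap bounds the same pairing below by
    a multiple of t^2 |F|_2^2 >= t^2 |F|_1^2. *)
Lemma L1_difference_estimate F g t : bounded_measurable F -> periodic F 1 ->
  itvint 0 1 F = 0 -> itvintegrable 0 1 g ->
  (forall x, 0 <= x < 1 -> F x - F 0 = itvint 0 x g) -> 0 < t < 1 ->
  t ^+ 2 * itvint 0 1 (fun x => `|F x|) <=
  16 * itvint 0 1 (fun x => `|g x - (F (x + t) - F (x - t)) / (2 * t)|).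
Proof.
move=> bF pF F0 ig Fg t01; have /andP[t0 t1] := t01.
pose W x := itvint (- t) t (fun s => F (x + s)).
pose G x := F x - W x / (2 * t).
pose D x := (F (x + t) - F (x - t)) / (2 * t).
set gamma := itvint 0 1 (fun x => `|g x - D x|).
set m := itvint 0 1 (fun x => `|F x|).
have bFs s : bounded_measurable (fun x => F (x + s)).
  exact: bounded_measurable_shift.
have iB a b h : bounded_measurable h -> itvintegrable a b h.
  exact: bounded_measurable_integrable.
have bD : bounded_measurable D.
  apply: bounded_measurableM; last exact: bounded_measurable_cst.
  exact: bounded_measurableB.
have bW : bounded_measurable W.
  have [mF [M FM]] := bF.
  apply: (@bounded_measurable_itvint _ _ _ (fun z => F (z.1 + z.2)) M) => //.
  by apply: measurableT_comp => //; exact: measurable_funD.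
have bG : bounded_measurable G.
  apply: bounded_measurableB => //; apply: bounded_measurableM => //.
  exact: bounded_measurable_cst.
have WE x : W x = itvint (x - t) (x + t) F.
  rewrite addrC [x + t]addrC -itvint_shift//.
  by apply: itvint_eq => s _; rewrite addrC.
have igD : itvintegrable 0 1 (fun x => g x - D x).
  by apply: itvintegrableB => //; exact: iB.
have Gprimitive x : 0 <= x < 1 -> G x - G 0 = itvint 0 x (fun y => g y - D y).
  move=> /andP[x0 x1]; rewrite itvintB; last 2 first.
  - by apply: itvintegrable_sub ig => //; exact: ltW.
  - exact: iB.
  rewrite -Fg ?x0//.
  have DE : itvint 0 x D = (2 * t)^-1 * itvint 0 x (fun y => F (y + t) - F (y - t)).
    rewrite -itvintZ; first by apply: itvint_eq => y _; rewrite mulrC.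
    by apply: iB; exact: bounded_measurableB.
  rewrite DE itvintB; [|exact: iB ..].
  rewrite !itvint_shift// /G !WE !add0r.
  (* both sides split the interval from - t to x + t *)
  have e1 := itvint_split (a := - t) (b := x - t) (c := x + t) (u := F).
  have e2 := itvint_split (a := - t) (b := t) (c := x + t) (u := F).
  have {e1}e1 := e1 ltac:(lra) ltac:(lra) (iB _ _ _ bF).
  have {e2} := e2 ltac:(lra) ltac:(lra) (iB _ _ _ bF).
  rewrite e1 => e.
  have -> : itvint t (x + t) F =
      itvint (- t) (x - t) F + itvint (x - t) (x + t) F - itvint (- t) t F by lra.
  by field; rewrite gt_eqF.
have Gbound x : 0 <= x < 1 -> `|G x - G 0| <= gamma.
  move=> x01; have /andP[x0 x1] := x01; rewrite Gprimitive//.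
  have igx : itvintegrable 0 x (fun y => g y - D y).
    by apply: itvintegrable_sub igD => //; exact: ltW.
  rewrite (le_trans (ler_norm_itvint igx))//.
  apply: le_itvint_subset => //; first exact: ltW.
  exact: itvintegrable_norm.
have bFG := bounded_measurableM bF bG.
have bNF := bounded_measurable_norm bF.
have FG : itvint 0 1 (fun x => F x * G x) <= gamma * m.
  have -> : itvint 0 1 (fun x => F x * G x) = itvint 0 1 (fun x => F x * (G x - G 0)).
    have G0F : itvint 0 1 (fun x => G 0 * F x) = 0.
      by rewrite itvintZ ?F0 ?mulr0//; exact: iB.
    rewrite -[LHS]subr0 -[X in _ - X]G0F.
    rewrite -itvintB; [|exact: iB|by apply: itvintegrableZ; exact: iB].
    by apply: itvint_eq => x _; ring.
  rewrite -itvintZ; last exact: iB.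
  apply: le_itvint => [||x x01].
  - apply: iB; apply: bounded_measurableM => //; apply: bounded_measurableB => //.
    exact: bounded_measurable_cst.
  - by apply: itvintegrableZ; exact: iB.
  - rewrite (le_trans (ler_norm _))// normrM mulrC ler_wpM2r//.
    exact: Gbound.
have gamma0 : 0 <= gamma by exact: itvint_ge0.
have m0 : 0 <= m by exact: itvint_ge0.
(* t^2 m^2 <= 16 gamma m, to be divided by m *)
have [mz|mn] := eqVneq m 0; first by rewrite mz mulr0 mulr_ge0.
rewrite -(@ler_pM2r _ m) ?lt_def ?mn//.
have gap := spectral_gap bF pF F0 t01.
have msq := sqr_itvint01_le bF.
have : t ^+ 2 * m ^+ 2 <= t ^+ 2 * itvint 0 1 (fun x => F x ^+ 2).
  by rewrite ler_wpM2l ?exprn_ge0// ltW.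
move: gap; rewrite -/(itvint 0 1 (fun x => F x * G x)) -/m => gap H.
by rewrite -mulrA -[m * m]/(m ^+ 2) -mulrA; lra.
Qed.
End difference_estimate.

(** * Smooth test functions *)

Section elementary_functions.
Set Implicit Arguments.
Unset Strict Implicit.
Context {R : realType}.
Implicit Types (a b c w x y : R) (u v : R -> R).

(** A class of functions closed under differentiation, so that all its members
    are smooth: this avoids a calculus of higher derivatives. *)
Inductive elementary : (R -> R) -> Prop :=
| elementary_cst c : elementary (fun=> c)
| elementary_sin w b : elementary (fun x => sin (w * x + b))
| elementary_cos w b : elementary (fun x => cos (w * x + b))
| elementaryD u v : elementary u -> elementary v ->
    elementary (fun x => u x + v x)
| elementaryM u v : elementary u -> elementary v ->
    elementary (fun x => u x * v x)
| elementary_exp u : elementary u -> elementary (fun x => expR (u x)).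

Lemma elementary_is_derive u : elementary u ->
  exists2 v, elementary v & forall x, is_derive x (1 : R) u (v x).
Proof.
have affine w b x : is_derive x (1 : R) (fun x => w * x + b) w.
  have := is_deriveD (is_deriveZ w (is_derive_id x (1 : R))) (is_derive_cst b x 1).
  by rewrite /GRing.scale/= mulr1 addr0.
elim=> {u} [c|w b|w b|u v eu [u' eu' du] ev [v' ev' dv]
          |u v eu [u' eu' du] ev [v' ev' dv]|u eu [u' eu' du]].
- by exists (fun=> 0); [exact: elementary_cst|move=> x; exact: is_derive_cst].
- exists (fun x => cos (w * x + b) * w).
    by apply: elementaryM; [exact: elementary_cos|exact: elementary_cst].
  by move=> x; exact: (is_derive1_comp (f := sin)).
- exists (fun x => (-1 * sin (w * x + b)) * w).
    apply: elementaryM; last exact: elementary_cst.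
    by apply: elementaryM; [exact: elementary_cst|exact: elementary_sin].
  by move=> x; rewrite mulN1r; exact: (is_derive1_comp (f := cos)).
- exists (fun x => u' x + v' x); first exact: elementaryD.
  by move=> x; exact: is_deriveD.
- exists (fun x => u x * v' x + v x * u' x).
    by apply: elementaryD; exact: elementaryM.
  by move=> x; exact: is_deriveM.
- exists (fun x => expR (u x) * u' x).
    by apply: elementaryM => //; exact: elementary_exp.
  by move=> x; exact: (is_derive1_comp (f := expR)).
Qed.

Lemma elementary_derivable u x : elementary u -> derivable u x 1.
Proof. by move=> /elementary_is_derive[v _ /(_ x) []]. Qed.

Lemma elementary_derive1n u n : elementary u -> elementary (u^`(n))%classic.
Proof.
elim: n u => // n IH u /elementary_is_derive[v ev duv].
rewrite derive1Sn (_ : (u^`())%classic = v); first exact: IH.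
by apply/funext => x; rewrite derive1E; exact: derive_val.
Qed.

Lemma elementary_continuous u : elementary u -> continuous u.
Proof.
move=> eu x; apply: differentiable_continuous.
exact/derivable1_diffP/elementary_derivable.
Qed.

Lemma continuous_itvintegrable a b u : continuous u -> itvintegrable a b u.
Proof.
move=> cu; have : lebesgue_measure.-integrable `[a, b] (EFin \o u).
  apply: continuous_compact_integrable; first exact: segment_compact.
  exact: continuous_subspaceT.
by apply: integrableS => //; apply: subset_itvl; rewrite bnd_simp.
Qed.

(** One of the two terms is zero, according to the sign of x. *)
Definition primitive u x := itvint 0 x u - itvint x 0 u.

Lemma itvint_ge a b u : b <= a -> itvint a b u = 0.
Proof.
by move=> ba; rewrite /itvint set_itv_ge ?Rintegral_set0// bnd_simp -leNgt.
Qed.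

Lemma primitive_pos u x : 0 <= x -> primitive u x = itvint 0 x u.
Proof. by move=> x0; rewrite /primitive (itvint_ge _ x0) subr0. Qed.

(** With a base point a to the left of x, the primitive is an integral with a
    variable upper bound only, to which the fundamental theorem applies. *)
Lemma primitive_shift u a x : continuous u -> a <= 0 -> a <= x ->
  primitive u x = itvint a x u - itvint a 0 u.
Proof.
move=> cu a0 ax; have iu b c := continuous_itvintegrable b c cu.
have [x0|/ltW x0] := leP 0 x.
  by rewrite primitive_pos// (itvint_split a0 x0)// addrAC subrr add0r.
by rewrite /primitive (itvint_ge _ x0) (itvint_split ax x0)// opprD addrA subrr.
Qed.

Lemma primitive_is_derive u x : continuous u ->
  is_derive x (1 : R) (primitive u) (u x).
Proof.
move=> cu; pose a := - (`|x| + 1).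
have a0 : a <= 0 by rewrite oppr_le0 addr_ge0.
have ax : a < x by rewrite ltrNl (le_lt_trans (ler_norm _))// normrN ltrDl.
have iu b c := continuous_itvintegrable b c cu.
have iau : lebesgue_measure.-integrable `[a, x + 1] (EFin \o u).
  apply: continuous_compact_integrable; first exact: segment_compact.
  exact: continuous_subspaceT.
have xx1 : x < x + 1 by rewrite ltrDl.
have abx : (BLeft a < BRight x)%E by rewrite lte_fin.
have [] := continuous_FTC1 xx1 iau abx (cu x).
set F := fun x => _ => dF F'.
have Fder : is_derive x (1 : R) F (u x).
  by apply: DeriveDef; [exact: dF|rewrite -derive1E F'].
have FBder : is_derive x (1 : R) (F - cst (itvint a 0 u)) (u x).
  by have := is_deriveB Fder (is_derive_cst (itvint a 0 u) x 1); rewrite subr0.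
apply: near_eq_is_derive FBder; near=> y.
have ay : a <= y by near: y; apply: lt_le_nbhsr.
rewrite (primitive_shift cu a0 ay) /F/=; congr (_ - _).
by rewrite /itvint Rintegral_itv_bndo_bndc//; exact: iu.
Unshelve. all: end_near. Qed.

(** The increment of the primitive over a period has derivative zero, and it
    vanishes at 0 because u has mean zero. *)
Lemma smooth_primitive u : elementary u -> periodic u 1 -> itvint 0 1 u = 0 ->
  torus_smooth (primitive u).
Proof.
move=> eu pu u0; have cu := elementary_continuous eu.
have d1 : ((primitive u)^`())%classic = u.
  apply/funext => x; rewrite derive1E; apply: derive_val.
  exact: primitive_is_derive.
split=> [x|[|n] x]; last 2 first.
- by have [] := primitive_is_derive x cu.
- rewrite derive1Sn d1; apply: elementary_derivable.
  exact: elementary_derive1n.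
have dshift z : is_derive z (1 : R) (fun y => primitive u (y + 1)) (u (z + 1)).
  have dz : is_derive z (1 : R) (fun y : R => y + 1) 1.
    have := is_deriveD (is_derive_id z (1 : R)) (is_derive_cst (1 : R) z 1).
    by rewrite addr0.
  have := @is_derive1_comp R (primitive u) (fun y => y + 1) z _ _
    (primitive_is_derive (z + 1) cu) dz.
  by rewrite mulr1.
have dz z : is_derive z (1 : R)
    ((fun y => primitive u (y + 1)) - primitive u) 0.
  have := is_deriveB (dshift z) (primitive_is_derive z cu).
  by rewrite pu subrr.
have p1 : primitive u 1 = 0 by rewrite primitive_pos.
have p0 : primitive u 0 = 0 by rewrite primitive_pos// itvint_ge.
by have := is_derive_0_is_cst x 0 dz; rewrite !fctE add0r p1 p0 subrr => /subr0_eq.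
Qed.

End elementary_functions.

(** * Smooth approximations of the indicator of [0, a[ *)

Section smooth_indicator.
Set Implicit Arguments.
Unset Strict Implicit.
Context {R : realType}.
Notation mu := (@lebesgue_measure R).
Implicit Types (a b c w x y : R) (u v f g h : R -> R).

Lemma itvint_cvg a b (h_ : nat -> R -> R) h G :
  (forall n, measurable_fun setT (h_ n)) -> measurable_fun setT h ->
  itvintegrable a b G ->
  {ae mu, forall x, a <= x < b -> h_ n x @[n --> \oo] --> h x} ->
  (forall n x, a <= x < b -> `|h_ n x| <= G x) ->
  itvint a b (h_ n) @[n --> \oo] --> itvint a b h.
Proof.
move=> mh_ mh iG hcvg hG.
have [|||||ih _ cvgint] := @dominated_convergence _ _ R mu `[a, b[%classic
  (measurable_itv _) (fun n => EFin \o h_ n) (EFin \o h) (EFin \o G).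
- by move=> n; apply/measurable_EFinP; exact: measurable_funS (mh_ n).
- by apply/measurable_EFinP; exact: measurable_funS mh.
- apply: (@filterS _ _ (ae_filter_ringOfSetsType mu) _ _ _ hcvg) => x hx xab.
  apply: cvg_EFin; first exact: nearW.
  by apply: hx; rewrite /= in_itv in xab.
- exact: iG.
- by apply: aeW => x n /=; rewrite in_itv/= => /hG; rewrite lee_fin.
apply: fine_cvg; rewrite itvintE//.
Qed.

(** Equal to (cos (pi (2 x - a)) - cos (pi a)) / 2, hence 1-periodic; if
    0 < a < 1, it is positive on ]0, a[ and negative on ]a, 1[. *)
Let hill a x := sin (pi * x + 0) * sin (- pi * x + pi * a).

(** As n grows, the double exponential tends to 1 where the hill is positive and
    to 0 where it is negative. *)
Definition smooth_indicator a n x := expR (-1 * expR (- n%:R * hill a x)).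

Lemma smooth_indicator_elementary a n : elementary (smooth_indicator a n).
Proof.
apply: elementary_exp; apply: elementaryM; first exact: elementary_cst.
apply: elementary_exp; apply: elementaryM; first exact: elementary_cst.
by apply: elementaryM; exact: elementary_sin.
Qed.

Lemma smooth_indicator_periodic a n : periodic (smooth_indicator a n) 1.
Proof.
move=> x; rewrite /smooth_indicator; suff -> : hill a (x + 1) = hill a x by [].
rewrite /hill [in RHS](_ : - pi * x + _ = - pi * (x + 1) + pi * a + pi); last ring.
rewrite (_ : pi * (x + 1) + 0 = pi * x + 0 + pi); last ring.
by rewrite !sinDpi mulrN mulNr.
Qed.

Lemma smooth_indicator_ge0 a n x : 0 <= smooth_indicator a n x.
Proof. exact: expR_ge0. Qed.

Lemma smooth_indicator_le1 a n x : smooth_indicator a n x <= 1.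
Proof. by rewrite expR_le1 mulN1r oppr_le0 expR_ge0. Qed.

Let cvg_expRn r : 0 < r -> expR (- n%:R * r) @[n --> \oo] --> (0 : R).
Proof.
move=> r0; rewrite (_ : (fun n => _) = (GRing.exp (expR (- r)))).
  by apply: cvg_expr; rewrite ger0_norm ?expR_ge0// expR_lt1 oppr_lt0.
by apply/funext => n; rewrite -expRM_natl; congr expR; ring.
Qed.

Lemma smooth_indicator_cvg1 a x : a < 1 -> 0 < x < a ->
  smooth_indicator a n x @[n --> \oo] --> (1 : R).
Proof.
move=> a1 /andP[x0 xa].
have hill0 : 0 < hill a x.
  have p0 := pi_gt0 R.
  by rewrite mulr_gt0// sin_gt0_pi//; nra.
rewrite -expR0 -[X in expR X](mulr0 (-1)); apply: (cvg_comp _ expR).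
  by apply: cvgM; [exact: cvg_cst|exact: cvg_expRn].
exact: continuous_expR.
Qed.

Lemma smooth_indicator_cvg0 a x : 0 < a -> a < x < 1 ->
  smooth_indicator a n x @[n --> \oo] --> (0 : R).
Proof.
move=> a0 /andP[ax x1].
have hill0 : 0 < - hill a x.
  have p0 := pi_gt0 R; rewrite /hill.
  rewrite (_ : - pi * x + pi * a = - (pi * (x - a))); last ring.
  by rewrite sinN mulrN opprK mulr_gt0// sin_gt0_pi//; nra.
apply: (@squeeze_cvgr _ _ _ _ (fun=> 0) (fun n => expR (- n%:R * - hill a x))).
- apply: nearW => n; rewrite smooth_indicator_ge0/= ler_expR mulN1r.
  rewrite mulrN lerN2.
  by rewrite (le_trans _ (expR_ge1Dx _))// lerDr.
- exact: cvg_cst.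
- exact: cvg_expRn.
Qed.

Lemma smooth_indicator_ae a : 0 < a < 1 ->
  {ae mu, forall x, 0 <= x < 1 ->
    smooth_indicator a n x @[n --> \oo] --> ((x < a)%R%:R : R)}.
Proof.
move=> /andP[a0 a1]; exists [set 0; a]; split.
- exact: measurableU.
- by apply: countable_lebesgue_measure0; apply: finite_set_countable.
- move=> x /= /not_implyP[/andP[x0 x1]] ncvg.
  have [->|xn0] := eqVneq x 0; first by left.
  have [->|xna] := eqVneq x a; first by right.
  exfalso; apply: ncvg; have [xa|ax] := ltP x a.
    by apply: smooth_indicator_cvg1; rewrite // lt_def xn0 x0.
  by apply: smooth_indicator_cvg0; rewrite // lt_def xna ax.
Qed.

End smooth_indicator.

(** * From smooth test functions to indicators *)

Section weak_derivatives.
Set Implicit Arguments.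
Unset Strict Implicit.
Context {R : realType}.
Notation mu := (@lebesgue_measure R).
Implicit Types (a b c x y : R).
Variables f g : R -> R.
Hypotheses (mf : measurable_fun setT f) (mg : measurable_fun setT g).
Hypotheses (intf : itvintegrable 0 1 f) (intg : itvintegrable 0 1 g).
Hypothesis weak : forall phi, torus_smooth phi ->
  itvint 0 1 (fun x => f x * derive1 phi x) = - itvint 0 1 (fun x => g x * phi x).
Hypothesis f0 : itvint 0 1 f = 0.

(** Test with the constant function 1. *)
Lemma weak_derivative_mean0 : itvint 0 1 g = 0.
Proof.
have s1 : torus_smooth (fun=> 1 : R).
  split=> // n x; apply: elementary_derivable; apply: elementary_derive1n.
  exact: elementary_cst.
have := weak s1; under [X in - X]itvint_eq do rewrite mulr1.
rewrite (itvint_eq (v := fun=> 0)); last by move=> x _; rewrite derive1_cst mulr0.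
by rewrite itvint_cst// mul0r => /esym/eqP; rewrite oppr_eq0 => /eqP.
Qed.

Let step a x : R := (x < a)%R%:R.

Let measurable_step a : measurable_fun setT (step a).
Proof.
rewrite (_ : step a = \1_`]-oo, a[); first exact: measurable_indic.
apply/funext => x; rewrite indicE /step; congr (nat_of_bool _)%:R.
by apply/idP/idP; rewrite inE/= in_itv.
Qed.

Let norm_step a x : `|step a x| <= 1.
Proof. by rewrite /step; case: ltP => _; rewrite ?normr1 ?normr0. Qed.

Let bounded_step a : bounded_measurable (step a).
Proof. by split=> //; exists 1. Qed.

Let bounded_smooth a n : bounded_measurable (smooth_indicator a n).
Proof.
split.
  apply: continuous_measurable_fun; apply: elementary_continuous.
  exact: smooth_indicator_elementary.
by exists 1 => x; rewrite ger0_norm ?smooth_indicator_ge0 ?smooth_indicator_le1.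
Qed.

Let norm_smooth a n x : `|smooth_indicator a n x| <= 1.
Proof. by rewrite ger0_norm ?smooth_indicator_ge0 ?smooth_indicator_le1. Qed.

Lemma itvint_step a b h : 0 <= b -> 0 <= a -> measurable_fun setT h ->
  itvintegrable 0 b h ->
  itvint 0 b (fun x => h x * step a x) = itvint 0 (Num.min b a) h.
Proof.
move=> b0 a0 mh ih; have [ba|/ltW ab] := leP b a.
  apply: itvint_eq => x /andP[_ xb].
  by rewrite /step (lt_le_trans xb ba) mulr1.
have ihs : itvintegrable 0 b (fun x => h x * step a x).
  apply: dominated_itvintegrable (itvintegrable_norm ih) _.
    exact: measurable_funM.
  by move=> x _; rewrite normrM ler_piMr.
rewrite (itvint_split a0 ab ihs) (itvint_eq (v := h)); last first.
  by move=> x /andP[_ xa]; rewrite /step xa mulr1.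
rewrite [X in _ + X](itvint_eq (v := fun=> 0)); last first.
  by move=> x /andP[ax _]; rewrite /step ltNge ax mulr0.
by rewrite itvint_cst// mul0r addr0.
Qed.

Let smooth_cvg a b h : 0 < a < 1 -> 0 <= b <= 1 -> measurable_fun setT h ->
  itvintegrable 0 1 h ->
  itvint 0 b (fun x => h x * smooth_indicator a n x) @[n --> \oo] -->
  itvint 0 (Num.min b a) h.
Proof.
move=> a01 /andP[b0 b1] mh ih; have /andP[a0 a1] := a01.
have ihb : itvintegrable 0 b h by exact: itvintegrable_sub ih.
rewrite -(itvint_step b0 (ltW a0) mh ihb).
apply: (@itvint_cvg _ _ _ (fun n x => h x * smooth_indicator a n x) _ (fun x => `|h x|)).
- by move=> n; apply: measurable_funM => //; exact: (bounded_smooth a n).1.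
- exact: measurable_funM.
- exact: itvintegrable_norm.
- apply: (@filterS _ _ (ae_filter_ringOfSetsType mu) _ _ _ (smooth_indicator_ae a01)).
  move=> x cvgx /andP[x0 xb]; apply: cvgM; first exact: cvg_cst.
  by apply: cvgx; rewrite x0 (lt_le_trans xb).
- by move=> n x _; rewrite normrM ler_piMr.
Qed.

(** Test with the primitive of a smoothed indicator of [0, a[ minus its mean,
    and pass to the limit by dominated convergence: the derivative of the test
    function tends to the indicator of [0, a[ minus a, and the test function
    itself to x |-> min x a - a x. The term in a drops out because f has mean
    zero. *)
Lemma weak_derivative_itvint a : 0 < a < 1 ->
  itvint 0 a f = - itvint 0 1 (fun x => g x * (Num.min x a - a * x)).
Proof.
move=> a01; have /andP[a0 a1] := a01.
pose psi n := smooth_indicator a n; pose m n := itvint 0 1 (psi n).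
pose u n x := psi n x + - m n.
have eu n : elementary (u n).
  apply: elementaryD; first exact: smooth_indicator_elementary.
  exact: elementary_cst.
have ipsi n x y : itvintegrable x y (psi n).
  by apply: bounded_measurable_integrable; exact: bounded_smooth.
have icst x y c : itvintegrable x y (fun=> c).
  exact/bounded_measurable_integrable/bounded_measurable_cst.
have pu n : periodic (u n) 1.
  by move=> x; congr (_ + _); exact: smooth_indicator_periodic.
have primE n x : 0 <= x -> primitive (u n) x = itvint 0 x (psi n) - m n * x.
  move=> x0; rewrite primitive_pos// itvintD//.
  by rewrite itvint_cst// subr0 mulNr.
have u0 n : itvint 0 1 (u n) = 0.
  by rewrite -primitive_pos// primE// mulr1 subrr.
have weakn n : itvint 0 1 (fun x => f x * u n x) =
    - itvint 0 1 (fun x => g x * primitive (u n) x).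
  rewrite -(weak (smooth_primitive (eu n) (pu n) (u0 n))).
  apply: itvint_eq => x _; congr (_ * _); rewrite derive1E; symmetry.
  by apply: derive_val; apply: primitive_is_derive; exact: elementary_continuous.
have min1 : Num.min 1 a = a by rewrite min_r// ltW.
have psi_cvg x : 0 <= x <= 1 -> itvint 0 x (psi n) @[n --> \oo] --> Num.min x a.
  move=> x01; have /andP[x0 _] := x01.
  have := @smooth_cvg a x (fun=> 1) a01 x01 (measurable_cst _) (icst _ _ _).
  rewrite itvint_cst ?mul1r ?subr0; last by rewrite le_min x0 ltW.
  rewrite (_ : (fun n => _) = (fun n => itvint 0 x (psi n)))//.
  by apply/funext => n; apply: itvint_eq => y _; rewrite mul1r.
have m_cvg : m n @[n --> \oo] --> a.
  by rewrite -[X in _ --> X]min1; apply: psi_cvg; rewrite ler01 lexx.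
have lhs : itvint 0 1 (fun x => f x * u n x) @[n --> \oo] --> itvint 0 a f.
  have fpsi n : itvintegrable 0 1 (fun x => f x * psi n x).
    apply: dominated_itvintegrable (itvintegrable_norm intf) _.
      by apply: measurable_funM => //; exact: (bounded_smooth a n).1.
    by move=> x _; rewrite normrM ler_piMr//; exact: norm_smooth.
  rewrite (_ : (fun n => _) = (fun n => itvint 0 1 (fun x => f x * psi n x))).
    have := smooth_cvg a01 _ mf intf (b := 1); rewrite min1; apply.
    by rewrite ler01 lexx.
  apply/funext => n; rewrite -[RHS]subr0 -[X in _ - X](mulr0 (m n)).
  rewrite -[X in m n * X]f0 -itvintZ// -itvintB//; last exact: itvintegrableZ.
  by apply: itvint_eq => x _; rewrite /u; ring.
have rhs : itvint 0 1 (fun x => g x * primitive (u n) x) @[n --> \oo] -->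
    itvint 0 1 (fun x => g x * (Num.min x a - a * x)).
  apply: (@itvint_cvg _ _ _ (fun n x => g x * primitive (u n) x) _
    (fun x => `|g x| * 2)).
  - move=> n; apply: measurable_funM => //; apply: continuous_measurable_fun => x.
    apply: differentiable_continuous; apply/derivable1_diffP.
    by have [] := primitive_is_derive x (elementary_continuous (eu n)).
  - apply: measurable_funM => //; apply: measurable_funB => //.
    exact: measurable_minr.
  - rewrite (_ : (fun x => _) = (fun x => 2 * `|g x|)); last first.
      by apply/funext => x; rewrite mulrC.
    by apply: itvintegrableZ; exact: itvintegrable_norm.
  - apply: aeW => x /andP[x0 x1]; apply: cvgM; first exact: cvg_cst.
    rewrite (_ : (fun n => _) = (fun n => itvint 0 x (psi n) - m n * x)).
      apply: cvgB; first by apply: psi_cvg; rewrite x0 ltW.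
      by apply: cvgM => //; exact: cvg_cst.
    by apply/funext => n; rewrite primE.
  - move=> n x /andP[x0 x1]; rewrite normrM ler_wpM2l// primE//.
    have psi1 y : 0 <= y <= 1 -> 0 <= itvint 0 y (psi n) <= y.
      move=> /andP[y0 y1]; apply/andP; split.
        by apply: itvint_ge0 => z; exact: smooth_indicator_ge0.
      rewrite -[X in _ <= X]subr0 -[X in _ <= X]mul1r -itvint_cst//.
      by apply: le_itvint => // z _; exact: smooth_indicator_le1.
    have /andP[Ix0 Ix1] : 0 <= itvint 0 x (psi n) <= x by apply: psi1; rewrite x0 ltW.
    have /andP[m0 m1] : 0 <= m n <= 1 by apply: psi1; rewrite ler01 lexx.
    by rewrite ler_norml; apply/andP; split; nra.
have := cvg_unique (@Rhausdorff R) lhs; apply.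
rewrite (_ : (fun n => _) =
    (fun n => - itvint 0 1 (fun x => g x * primitive (u n) x))).
  exact: cvgN.
by apply/funext.
Qed.
End weak_derivatives.

(** * The absolutely continuous representative *)

Section absolutely_continuous_representative.
Set Implicit Arguments.
Unset Strict Implicit.
Context {R : realType}.
Notation mu := (@lebesgue_measure R).
Implicit Types (a b c x y : R).

Lemma itvint0 a b : itvint a b (fun=> 0 : R) = 0.
Proof.
by have [ab|/ltW ba] := leP a b; [rewrite itvint_cst// mul0r|exact: itvint_ge].
Qed.

Lemma bounded_measurable_gt y : bounded_measurable (fun x => (y < x)%R%:R : R).
Proof.
split; last by exists 1 => x; case: ltP => _; rewrite ?normr1 ?normr0.
rewrite (_ : (fun x => _) = \1_`]y, +oo[); first exact: measurable_indic.
apply/funext => x; rewrite indicE; congr (nat_of_bool _)%:R.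
by apply/idP/idP; rewrite inE/= in_itv/= andbT.
Qed.

Lemma itvint_gt a b y : a <= y -> y <= b ->
  itvint a b (fun x => (y < x)%R%:R : R) = b - y.
Proof.
move=> ay yb; pose step x : R := (y < x)%R%:R.
have i c d : itvintegrable c d step.
  exact/bounded_measurable_integrable/bounded_measurable_gt.
rewrite (itvint_split ay yb)//.
rewrite (itvint_eq (v := fun=> 0)) ?itvint0 ?add0r; last first.
  by move=> x /andP[_ /ltW xy]; rewrite ltNge xy.
rewrite /itvint -Rintegral_itv_obnd_cbnd; last first.
  by apply: integrableS (i y b) => //; apply: subset_itvr; rewrite bnd_simp.
transitivity (itvint y b (fun=> 1 : R)); last by rewrite itvint_cst// mul1r.
rewrite /itvint -[RHS]Rintegral_itv_obnd_cbnd.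
  by apply: eq_Rintegral => x; rewrite inE/= in_itv/= => /andP[-> _].
have : itvintegrable y b (fun=> 1 : R).
  exact/bounded_measurable_integrable/bounded_measurable_cst.
by apply: integrableS => //; apply: subset_itvr; rewrite bnd_simp.
Qed.

Let frac x := x - (Num.floor x)%:~R.

Lemma frac_id x : 0 <= x < 1 -> frac x = x.
Proof.
by move=> x01; rewrite /frac (@floor_def _ x 0) ?subr0// add0r.
Qed.

Lemma frac_periodic : periodic frac 1.
Proof.
move=> x; rewrite /frac; have -> : Num.floor (x + 1) = Num.floor x + 1.
  apply: floor_def; have /andP[] := floor_itv x.
  by rewrite !intrD1 lerD2r ltrD2r => -> ->.
by rewrite intrD1 opprD addrACA subrr addr0.
Qed.

Lemma measurable_frac : measurable_fun setT frac.
Proof.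
apply: measurable_funB => //; apply: nondecreasing_measurable => // x y xy.
by rewrite ler_int le_floor.
Qed.

(** The primitive of f - F, extended by zero, vanishes identically, and by
    Lebesgue's differentiation theorem its derivative is f - F almost
    everywhere. *)
Lemma ae_eq_itvint (f F : R -> R) :
  itvintegrable 0 1 f -> itvintegrable 0 1 F ->
  (forall a, 0 < a <= 1 -> itvint 0 a f = itvint 0 a F) ->
  {ae mu, forall x, 0 <= x < 1 -> f x = F x}.
Proof.
move=> intf intF fF; pose h := (f \- F) \_ `[0, 1[.
have intfF : itvintegrable 0 1 (f \- F) by exact: itvintegrableB.
have inth : mu.-integrable setT (EFin \o h).
  have := intfF; rewrite /itvintegrable integrable_mkcond//.
  by rewrite restrict_EFin.
have ih A : measurable A -> mu.-integrable A (EFin \o h).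
  by move=> mA; exact: integrableS inth.
have h0 x : ~~ (0 <= x < 1) -> h x = 0.
  by move=> xn; rewrite /h patchE memNset//= in_itv/=; exact/negP.
have h1 x : 0 <= x < 1 -> h x = f x - F x.
  by move=> x01; rewrite /h patchE mem_set//= in_itv.
(* the lower bound -1 lies to the left of 0, so that x = 0 is not excluded *)
have H0 x : \int[mu]_(t in `[-1, x]) h t = 0.
  rewrite -Rintegral_itv_bndo_bndc; last exact: ih.
  rewrite -/(itvint (-1) x h).
  have [x0|x0] := ltP 0 x; last first.
    rewrite (itvint_eq (v := fun=> 0)) ?itvint0// => y /andP[_ yx].
    by rewrite h0// negb_and -ltNge (lt_le_trans yx x0).
  rewrite (@itvint_split _ (-1) 0) ?ltW//; last exact: ih.
  rewrite (itvint_eq (v := fun=> 0)) ?itvint0 ?add0r; last first.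
    by move=> y /andP[_ y0]; rewrite h0// negb_and -ltNge y0.
  have small a : 0 < a <= 1 -> itvint 0 a h = 0.
    move=> /andP[a0 a1]; transitivity (itvint 0 a (f \- F)).
      apply: itvint_eq => y /andP[y0 ya].
      by rewrite h1// y0 (lt_le_trans ya).
    rewrite itvintB ?fF ?subrr ?a0//;
      by [exact: itvintegrable_sub intf|exact: itvintegrable_sub intF].
  have [x1|/ltW x1] := leP x 1; first by rewrite small// x0.
  rewrite (@itvint_split _ 0 1)//; last exact: ih.
  rewrite small ?ltr01 ?lexx// add0r.
  rewrite (itvint_eq (v := fun=> 0)) ?itvint0// => y /andP[y1 _].
  by rewrite h0// negb_and -leNgt y1 orbT.
have := @FTC1 R h (BLeft (-1)) (fun y => ih _ (measurable_itv _)).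
have loch : locally_integrable setT h.
  exact: integrable_locally.
move=> /(_ loch).
apply: (@filterS _ _ (ae_filter_ringOfSetsType mu)) => x Hx x01.
have /andP[x0 x1] := x01.
have [] := Hx; first by rewrite lte_fin; lra.
rewrite (_ : (fun x => _) = cst 0); last by apply/funext => y; exact: H0.
by rewrite derive1_cst h1// => _ /esym/subr0_eq.
Qed.

Section representative.
Variables f g : R -> R.
Hypotheses (mf : measurable_fun setT f) (mg : measurable_fun setT g).
Hypotheses (intf : itvintegrable 0 1 f) (intg : itvintegrable 0 1 g).
Hypothesis weak : forall phi, torus_smooth phi ->
  itvint 0 1 (fun x => f x * derive1 phi x) = - itvint 0 1 (fun x => g x * phi x).
Hypothesis f0 : itvint 0 1 f = 0.

(** The kernel that writes the primitive of g at x as an integral over the fixed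
    interval [0, 1[. *)
Let K (z : R * R) := g z.2 * (z.2 < z.1)%R%:R.

Let measurable_K : measurable_fun setT K.
Proof.
apply: measurable_funM; first exact: measurableT_comp.
rewrite (_ : (fun z : R * R => _) = \1_`]0, +oo[ \o (fun z => z.1 - z.2)).
  by apply: measurableT_comp; [exact: measurable_indic|exact: measurable_funB].
apply/funext => z; rewrite /= indicE; congr (nat_of_bool _)%:R.
by apply/idP/idP; rewrite inE/= in_itv/= andbT subr_gt0.
Qed.

Let Kg x y : `|K (x, y)| <= `|g y|.
Proof. by rewrite /K/= normrM ler_piMr//; case: ltP; rewrite ?normr1 ?normr0. Qed.

Let intKx b x : b <= 1 -> itvintegrable 0 b (fun y => K (x, y)).
Proof.
move=> b1; have ig : itvintegrable 0 b g by exact: itvintegrable_sub intg.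
apply: dominated_itvintegrable (itvintegrable_norm ig) (fun y _ => Kg x y).
exact: measurable_pairl.
Qed.

Let G x := itvint 0 1 (fun y => K (x, y)).

Let bounded_G : bounded_measurable G.
Proof.
split.
  apply: (@measurable_itvint R 0 1 K (fun y => `|g y|)) => //.
  - exact: itvintegrable_norm.
  - exact: measurableT_comp.
exists (itvint 0 1 (fun y => `|g y|)) => x.
rewrite (le_trans (ler_norm_itvint (intKx _ (lexx 1))))//.
by apply: le_itvint => //; [apply: itvintegrable_norm; exact: intKx|
  exact: itvintegrable_norm].
Qed.

Let GE x : 0 <= x <= 1 -> G x = itvint 0 x g.
Proof.
move=> /andP[x0 x1]; rewrite /G.
by rewrite (itvint_step (a := x))// min_r.
Qed.

(** Fubini: the integral of K (x, y) in x over [0, a[ is g y (a - min y a). *)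
Let itvintG a : 0 <= a <= 1 ->
  itvint 0 a G = itvint 0 1 (fun y => g y * (a - Num.min y a)).
Proof.
move=> /andP[a0 a1].
rewrite /G (@fubini_itvint R 0 a 0 1 K (fun y => `|g y|))//; last 2 first.
- exact: itvintegrable_norm.
- exact: measurableT_comp.
apply: itvint_eq => y /andP[y0 y1].
have istep : itvintegrable 0 a (fun x => (y < x)%R%:R : R).
  exact/bounded_measurable_integrable/bounded_measurable_gt.
rewrite /K/= itvintZ//; congr (_ * _).
have [ya|ay] := leP y a; first exact: itvint_gt.
transitivity (itvint 0 a (fun=> 0 : R)); last by rewrite itvint0 subrr.
apply: itvint_eq => x /andP[_ xa].
by rewrite ltNge (ltW (lt_trans xa ay)).
Qed.

Let m := itvint 0 1 G.

Let F x := G (frac x) - m.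

Let bounded_F : bounded_measurable F.
Proof.
apply: bounded_measurableB; last exact: bounded_measurable_cst.
split; first exact: (measurableT_comp bounded_G.1 measurable_frac).
by have [_ [M GM]] := bounded_G; exists M => x.
Qed.

Let FE x : 0 <= x < 1 -> F x = G x - m.
Proof. by move=> x01; rewrite /F frac_id. Qed.

Let itvintF a : 0 <= a <= 1 -> itvint 0 a F = itvint 0 a G - a * m.
Proof.
move=> /andP[a0 a1].
rewrite (itvint_eq (v := fun x => G x - m)); last first.
  by move=> x /andP[x0 xa]; rewrite FE// x0 (lt_le_trans xa).
rewrite itvintB.
- by rewrite itvint_cst// subr0 mulrC.
- exact: bounded_measurable_integrable.
- exact/bounded_measurable_integrable/bounded_measurable_cst.
Qed.

(** F is the primitive of g from 0, reduced modulo 1 and shifted to mean zero.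
    Computing the integral of F over [0, a[ by Fubini gives the right-hand side
    of weak_derivative_itvint, so f and F have the same integrals over all the
    intervals [0, a[, and ae_eq_itvint applies. *)
Lemma weak_derivative_primitive : exists F : R -> R,
  [/\ bounded_measurable F, periodic F 1, itvint 0 1 F = 0,
    forall x, 0 <= x < 1 -> F x - F 0 = itvint 0 x g &
    {ae mu, forall x, 0 <= x < 1 -> f x = F x}].
Proof.
have g0 := weak_derivative_mean0 weak.
have F01 : itvint 0 1 F = 0.
  by rewrite itvintF ?ler01 ?lexx// mul1r subrr.
exists F; split => //.
- by move=> x; rewrite /F frac_periodic.
- move=> x x01; have /andP[x0 x1] := x01.
  rewrite !FE ?lexx ?ltr01// opprB addrA subrK !GE ?lexx ?ler01 ?x0 ?ltW//.
  by rewrite (itvint_ge _ (lexx 0)) subr0.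
- apply: ae_eq_itvint => //; first exact: bounded_measurable_integrable.
  move=> a /andP[a0]; rewrite le_eqVlt => /predU1P[->|a1]; first by rewrite F01.
  rewrite (weak_derivative_itvint mf mg intf intg weak f0) ?a0//.
  have ig c : 0 <= c <= 1 -> itvintegrable 0 1 (fun y => g y * (c - Num.min y c)).
    move=> /andP[c0 c1]; apply: dominated_itvintegrable (itvintegrable_norm intg) _.
      by apply: measurable_funM => //; apply: measurable_funB => //;
        exact: measurable_minr.
    move=> y /andP[y0 y1]; rewrite normrM ler_piMr// ger0_norm.
      by rewrite lerBlDr (le_trans c1)// lerDl le_min y0.
    by rewrite subr_ge0 ge_min lexx orbT.
  have a01 : 0 <= a <= 1 by rewrite !ltW.
  have one01 : 0 <= (1 : R) <= 1 by rewrite ler01 lexx.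
  rewrite itvintF// /m !itvintG// -itvintZ ?ig// -itvintB; [|exact: ig|].
    rewrite -mulN1r -itvintZ.
      apply: itvint_eq => y /andP[y0 y1].
      by rewrite (min_l (ltW y1)); ring.
    apply: dominated_itvintegrable (itvintegrable_norm intg) _.
      by apply: measurable_funM => //; apply: measurable_funB => //;
        exact: measurable_minr.
    move=> y /andP[y0 y1]; rewrite normrM ler_piMr// ger0_norm.
      rewrite lerBlDr ge_min; apply/orP; right.
      by have := ltW a0; nra.
    by rewrite subr_ge0 le_min; apply/andP; split; nra.
  by apply: itvintegrableZ; exact: ig.
Qed.

End representative.

End absolutely_continuous_representative.

(** * Translations on the torus and the conclusion *)

Section torus_translations.
Set Implicit Arguments.
Unset Strict Implicit.
Context {R : realType}.
Notation mu := (@lebesgue_measure R).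
Implicit Types (s x : R) (P : R -> Prop).

Lemma ae_shift s P : {ae mu, forall x, P x} -> {ae mu, forall x, P (x + s)}.
Proof.
move=> [N [mN N0 PN]]; exists ((fun x => x + s) @^-1` N); split.
- rewrite -[X in measurable X]setTI.
  have : measurable_fun setT (fun x : R => x + s) by exact: measurable_funD.
  exact.
- rewrite -[RHS]N0 -[RHS](lebesgue_measure_affine s ltr01 mN) mul1e.
  by congr (mu _); apply/funext => x; rewrite /preimage/= mul1r.
- by move=> x Px; exact: PN.
Qed.

Lemma tadd_itv x s : 0 <= x ⊕ s < 1.
Proof. by have := floor_itv (x + s); rewrite /tadd intrD1; lra. Qed.

(** On the fundamental domain, adding s modulo 1 agrees with one of the two
    translations by s - n and s - (n + 1), where n is the integer part of s. *)
Lemma ae_tadd s P : {ae mu, forall x, 0 <= x < 1 -> P x} ->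
  {ae mu, forall x, 0 <= x < 1 -> P (x ⊕ s)}.
Proof.
move=> aeP; pose n := Num.floor s.
have ae1 := ae_shift (s - n%:~R) aeP.
have ae2 := ae_shift (s - (n + 1)%:~R) aeP.
apply: (@filterS2 _ _ (ae_filter_ringOfSetsType mu) _ _ _ _ ae1 ae2).
move=> x P1 P2 /andP[x0 x1].
have sitv := floor_itv s.
have [xs|xs] := ltP (x + s) (n + 1)%:~R.
  have E : x ⊕ s = x + (s - n%:~R).
    rewrite /tadd (@floor_def _ _ n) ?addrA// xs andbT.
    by move: sitv; rewrite /n intrD1; lra.
  by rewrite E; apply: P1; rewrite -E tadd_itv.
have E : x ⊕ s = x + (s - (n + 1)%:~R).
  rewrite /tadd (@floor_def _ _ (n + 1)) ?addrA// xs/=.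
  by move: sitv; rewrite /n !intrD1; lra.
by rewrite E; apply: P2; rewrite -E tadd_itv.
Qed.

Lemma periodic_tadd (F : R -> R) x s : periodic F 1 -> F (x ⊕ s) = F (x + s).
Proof.
move=> pF; rewrite -[RHS](periodic_int (- Num.floor (x + s)) _ pF).
by rewrite mulrNz.
Qed.

Lemma measurable_tadd s : measurable_fun setT (fun x => x ⊕ s).
Proof.
by apply: (measurableT_comp measurable_frac); exact: measurable_funD.
Qed.

End torus_translations.

Theorem corollary1 (R : realType) :
  exists c : R, 0 < c /\
    forall (t : R) (f f' : R -> R),
      0 < t < 1 ->
      torus_W11 f -> is_weak_derivative f f' ->
      (\int[lebesgue_measure]_(x in torus) (f x)%:E = 0)%E ->
      ((c * t ^+ 2)%:E * \int[lebesgue_measure]_(x in torus) `|f x|%:E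
       <= \int[lebesgue_measure]_(x in torus)
            `|f' x - (f (x ⊕ t) - f (x ⊕ (- t))) / (2 * t)|%:E)%E.
Proof.
exists 16^-1; split=> [//|t f g t01 [L1f _] [L1g weak] f0].
(* nothing is known of f and g outside of the torus, where they need not even be
   measurable: they are replaced there by zero *)
have torusP (x : R) : torus x <-> 0 <= x < 1 by rewrite /torus/= in_itv.
have restrictE (h : R -> R) x : 0 <= x < 1 -> (h \_ torus) x = h x.
  by move=> /torusP x01; rewrite patchE mem_set.
have restrict_measurable (h : R -> R) : torus_L1 h -> measurable_fun setT (h \_ torus).
  move=> /(measurable_int lebesgue_measure)/measurable_EFinP mh.
  by apply/(measurable_restrictT _ _).1 => //; exact: measurable_itv.
have restrict_itvint (h k : R -> R) :
    itvint 0 1 (fun x => (h \_ torus) x * k x) =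
    fine (\int[lebesgue_measure]_(x in torus) (h x * k x)%:E)%E.
  by apply: itvint_eq => x x01; rewrite restrictE.
have restrict_integrable (h : R -> R) : torus_L1 h -> itvintegrable 0 1 (h \_ torus).
  apply: eq_integrable; first exact: measurable_itv.
  move=> x; rewrite inE => /torusP x01.
  by rewrite /= restrictE.
have weak01 phi : torus_smooth phi ->
    itvint 0 1 (fun x => (f \_ torus) x * derive1 phi x) =
    - itvint 0 1 (fun x => (g \_ torus) x * phi x).
  by move=> sphi; rewrite !restrict_itvint weak// fineN.
have f01 : itvint 0 1 (f \_ torus) = 0.
  rewrite (itvint_eq (v := fun x => (f \_ torus) x * 1)).
    rewrite restrict_itvint; under eq_integral do rewrite mulr1.
    by rewrite f0.
  by move=> x _; rewrite mulr1.
have [F [bF pF F0 Fprim aeF]] := weak_derivative_primitive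
  (restrict_measurable _ L1f) (restrict_measurable _ L1g)
  (restrict_integrable _ L1f) (restrict_integrable _ L1g) weak01 f01.
have aefF : {ae lebesgue_measure, forall x, 0 <= x < 1 -> f x = F x}.
  apply: (@filterS _ _ (ae_filter_ringOfSetsType lebesgue_measure) _ _ _ aeF).
  by move=> x + x01 => <-//; rewrite restrictE.
have mg : measurable_fun torus g.
  by apply/measurable_EFinP; exact: measurable_int L1g.
have mf : measurable_fun torus f.
  by apply/measurable_EFinP; exact: measurable_int L1f.
have mft s : measurable_fun torus (fun x => f (x ⊕ s)).
  rewrite (_ : (fun x => _) = (f \_ torus) \o (fun x => x ⊕ s)); last first.
    by apply/funext => x /=; rewrite restrictE// tadd_itv.
  apply: measurable_funTS; apply: measurableT_comp; last exact: measurable_tadd.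
  exact: restrict_measurable.
have bNF := bounded_measurable_norm bF.
have bD : bounded_measurable (fun x => (F (x + t) - F (x - t)) / (2 * t)).
  apply: bounded_measurableM; last exact: bounded_measurable_cst.
  by apply: bounded_measurableB; exact: bounded_measurable_shift.
have igD : itvintegrable 0 1
    (fun x => `|(g \_ torus) x - (F (x + t) - F (x - t)) / (2 * t)|).
  apply/itvintegrable_norm/itvintegrableB; first exact: restrict_integrable.
  exact: bounded_measurable_integrable.
have -> : (\int[lebesgue_measure]_(x in torus) `|f x|%:E =
    (itvint 0 1 (fun x => `|F x|))%:E)%E.
  rewrite itvintE; last exact: bounded_measurable_integrable.
  apply: ae_eq_integral; first exact: measurable_itv.
  - by apply/measurable_EFinP; exact: measurableT_comp.
  - by apply/measurable_EFinP; exact: measurable_funTS bNF.1.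
  - apply: (@filterS _ _ (ae_filter_ringOfSetsType lebesgue_measure) _ _ _ aefF).
    by move=> x + /torusP x01 => ->.
have -> : (\int[lebesgue_measure]_(x in torus)
      `|g x - (f (x ⊕ t) - f (x ⊕ (- t))) / (2 * t)|%:E =
    (itvint 0 1
      (fun x => `|(g \_ torus) x - (F (x + t) - F (x - t)) / (2 * t)|))%:E)%E.
  rewrite itvintE//; apply: ae_eq_integral; first exact: measurable_itv.
  - apply/measurable_EFinP; apply: measurableT_comp => //.
    apply: measurable_funB => //; apply: measurable_funM => //.
    by apply: measurable_funB; exact: mft.
  - exact: measurable_int igD.
  - apply: (@filterS2 _ _ (ae_filter_ringOfSetsType lebesgue_measure) _ _ _ _
      (ae_tadd t aefF) (ae_tadd (- t) aefF)).
    move=> x ft fNt /torusP x01.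
    by rewrite ft// fNt// !periodic_tadd// restrictE.
rewrite -EFinM lee_fin -mulrA ler_pdivrMl//.
exact: L1_difference_estimate bF pF F0 (restrict_integrable _ L1g) Fprim t01.
Qed.
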